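(* Let $(G,R)$ be a positively generated group, let $c\in G$ be a balanced element and let $P_c$ be its set of divisors. Suppose that any two elements of $R\cap P_c$ have a least common multiple in $P_c$. Then $M(P_c)$ is a quasi-Garside monoid with $\underline c$ as Garside element.
   Context: A positively generated group is a pair $(G,R)$ where $G$ is a group and $R\subset G$ (possibly infinite) generates $G$ as a monoid. $l_R(g)$ is the least number of factors in an expression of $g$ as a product of elements of $R$. If $g=hk$ with $l_R(g)=l_R(h)+l_R(k)$, then $h$ divides $g$ on the left and $k$ divides $g$ on the right. An element is balanced if its set of left divisors equals its set of right divisors; $P_c$ denotes this common set for a balanced $c$. Least common multiples in $P_c$ are taken in $P_c$ ordered by divisibility (for left divisibility and for right divisibility). $M(P_c)$ is the monoid generated by a set $\underline P_c=\{\underline w\mid w\in P_c\}$ in bijection with $P_c$, with relations $\underline w.\underline{w'}=\underline{ww'}$ for all $w,w'$ such that $w,w',ww'\in P_c$ and $l_R(ww')=l_R(w)+l_R(w')$. A monoid $M$ is quasi-Garside if: (i) for every $m\in M$ the number of factors (different from $1$) in a product equal to $m$ is bounded; (ii) $M$ is left and right cancellative; (iii) left divisibility and right divisibility give two lattice structures on $M$; (iv) there is an element $\Delta\in M$ (a Garside element) whose set of left divisors equals its set of right divisors and generates $M$. In a monoid, $a$ left-divides $m$ if $m\in aM$ and right-divides $m$ if $m\in Ma$.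
   Formalization: The relation that the generator $\underline 1$ equals the unit is added to the presentation of $M(P_c)$; with only the displayed relations $\underline 1$ is an idempotent different from the unit, so $M(P_c)$ is never cancellative. *)

(* Defs.v *)
From HB Require Import structures.
From mathcomp Require Import all_boot.
From mathcomp Require Export monoid.
From mathcomp Require Import boolp classical_sets.
Set Implicit Arguments.
Unset Strict Implicit.
Unset Printing Implicit Defensive.
Local Open Scope classical_set_scope.
Local Open Scope quotient_scope.
Local Open Scope group_scope.

(* Generation is always as a monoid: inverses are not used. *)
Definition monoid_generates (M : monoidType) (A : set M) : Prop :=
  forall m : M, exists2 s : seq M,
    (forall x, x \in s -> A x) & \prod_(x <- s) x = m.

Definition is_lub_in (T : Type) (A : set T) (le : T -> T -> Prop) (a b m : T)
    : Prop :=
  [/\ A m, le a m, le b m & forall x, A x -> le a x -> le b x -> le m x].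

Definition is_lattice (T : Type) (le : T -> T -> Prop) : Prop :=
  [/\ forall x, le x x,
      forall x y, le x y -> le y x -> x = y,
      forall x y z, le x y -> le y z -> le x z,
      forall x y, exists m, is_lub_in setT le x y m &
      forall x y, exists m, is_lub_in setT (fun u v => le v u) x y m].

Section QuasiGarside.
Variable M : monoidType.
Implicit Types a m D : M.

Definition mldvd a m : Prop := exists x : M, m = a * x.
Definition mrdvd a m : Prop := exists x : M, m = x * a.

Definition bounded_factorizations : Prop :=
  forall m : M, exists N : nat, forall s : seq M,
    (forall x, x \in s -> x <> 1) -> \prod_(x <- s) x = m -> (size s <= N)%N.

Definition left_cancellative : Prop :=
  forall x y z : M, x * y = x * z -> y = z.
Definition right_cancellative : Prop :=
  forall x y z : M, y * x = z * x -> y = z.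

Definition garside_element D : Prop :=
  (forall a, mldvd a D <-> mrdvd a D) /\
  monoid_generates [set a : M | mldvd a D].

Definition quasi_garside : Prop :=
  [/\ bounded_factorizations,
      left_cancellative /\ right_cancellative,
      is_lattice mldvd /\ is_lattice mrdvd &
      exists D : M, garside_element D].

End QuasiGarside.

(* The monoid presented by generators T and defining relations r: the quotient
   of the free monoid [seq T] by the congruence generated by r. *)
Section Presentation.
Variables (T : choiceType) (r : seq T -> seq T -> Prop).

Inductive gen_cong : seq T -> seq T -> Prop :=
| gen_cong_rel s t : r s t -> gen_cong s t
| gen_cong_refl s : gen_cong s s
| gen_cong_sym s t : gen_cong s t -> gen_cong t s
| gen_cong_trans s t u : gen_cong s t -> gen_cong t u -> gen_cong s u
| gen_cong_cat s s' t t' :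
    gen_cong s s' -> gen_cong t t' -> gen_cong (s ++ t) (s' ++ t').

Definition gen_congb : rel (seq T) := fun s t => `[< gen_cong s t >].

Lemma gen_congb_refl : reflexive gen_congb.
Proof. by move=> s; apply/asboolP/gen_cong_refl. Qed.

Lemma gen_congb_sym : symmetric gen_congb.
Proof. by move=> s t; apply/asboolP/asboolP; apply: gen_cong_sym. Qed.

Lemma gen_congb_trans : transitive gen_congb.
Proof.
move=> t s u /asboolP st /asboolP tu; apply/asboolP.
exact: gen_cong_trans st tu.
Qed.

Canonical gen_cong_equiv :=
  EquivRel gen_congb gen_congb_refl gen_congb_sym gen_congb_trans.

Definition presented := {eq_quot gen_congb}.

HB.instance Definition _ := Choice.on presented.
HB.instance Definition _ := Quotient.on presented.

Lemma presentedP (s t : seq T) :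
  \pi_presented s = \pi_presented t <-> gen_cong s t.
Proof.
split=> [/eqP|st]; first by rewrite eqmodE => /asboolP.
by apply/eqP; rewrite eqmodE; apply/asboolP.
Qed.

Definition presented_mul (x y : presented) : presented :=
  \pi_presented (repr x ++ repr y).
Definition presented_one : presented := \pi_presented [::].

Lemma presented_mul_pi (s t : seq T) :
  presented_mul (\pi s) (\pi t) = \pi_presented (s ++ t).
Proof.
by apply/presentedP/gen_cong_cat; apply/presentedP; rewrite reprK.
Qed.

Lemma presented_mulA : associative presented_mul.
Proof.
move=> x y z; rewrite -(reprK x) -(reprK y) -(reprK z).
by rewrite !presented_mul_pi catA.
Qed.

Lemma presented_mul1 : left_id presented_one presented_mul.
Proof. by move=> x; rewrite -(reprK x) presented_mul_pi. Qed.

Lemma presented_mulr1 : right_id presented_one presented_mul.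
Proof. by move=> x; rewrite -(reprK x) presented_mul_pi cats0. Qed.

HB.instance Definition _ := isMonoid.Build presented
  presented_mulA presented_mul1 presented_mulr1.

Definition presented_gen (x : T) : presented := \pi_presented [:: x].

End Presentation.

Section PositivelyGenerated.
Variables (G : groupType) (R : set G).
Implicit Types g h k c w : G.

Definition is_product_of_length g (n : nat) : Prop :=
  exists s : seq G,
    [/\ forall x, x \in s -> R x, size s = n & \prod_(x <- s) x = g].

(* l_R; the value 0 off the submonoid generated by R is never used when R
   generates G as a monoid. *)
Definition len g : nat :=
  if pselect (exists n, `[< is_product_of_length g n >]) is left ex
  then ex_minn ex else 0%N.

Definition ldvd h g : Prop :=
  exists k, g = h * k /\ len g = (len h + len k)%N.
Definition rdvd k g : Prop :=
  exists h, g = h * k /\ len g = (len h + len k)%N.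

Definition balanced c : Prop := forall w, ldvd w c <-> rdvd w c.

(* P_c: only used for balanced c, when these are also the right divisors. *)
Definition divs c : set G := [set w | ldvd w c].

Lemma len1 : len 1 = 0%N.
Proof.
rewrite /len; case: pselect => // ex; case: ex_minnP => n _ /(_ 0%N) n0.
apply/eqP; rewrite -leqn0; apply: n0; apply/asboolP.
by exists [::]; split=> //; rewrite big_nil.
Qed.

Lemma divs_self c : c \in divs c.
Proof. by apply/mem_set; exists 1; rewrite mulg1 len1 addn0. Qed.

(* Besides w.w' = (ww'), the generator attached to 1 is identified with the
   unit (the empty word): otherwise it would be an idempotent distinct from the
   unit, and the monoid would be neither cancellative nor of bounded length. *)
Inductive divs_rel c : seq (divs c) -> seq (divs c) -> Prop :=
| divs_rel_mul (w w' v : divs c) :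
    val v = val w * val w' ->
    len (val v) = (len (val w) + len (val w'))%N ->
    divs_rel [:: w; w'] [:: v]
| divs_rel_one (e : divs c) : val e = 1 -> divs_rel [:: e] [::].

Definition divs_monoid c : monoidType := presented (@divs_rel c).

Definition underline c (w : divs c) : divs_monoid c :=
  presented_gen (@divs_rel c) w.

Definition divs_top c : divs c := SigSub (divs_self c).

End PositivelyGenerated.

(* Main.v *)
Require Import Defs.
From mathcomp Require Import all_boot monoid boolp classical_sets.
From HB Require Import structures.
Local Open Scope classical_set_scope.

(** The divisors of a balanced element carry a partial product: [a b] is
    defined when the lengths add and the result divides [c]. A ternary relation
    [T a b v] with the axioms of [left_germ] records this product, and reversing
    its two factors records the partial product read from the right. The
    monoid is studied for left divisibility only; the statements about right
    divisibility are the same ones for the reversed germ and the converse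
    monoid.

    Three ideas carry the proof.

    - In a poset with a rank, it is enough to find joins just above each
      element ([bounded_joins]). Joins of atoms therefore make the divisors of
      [c] a lattice; in particular, for divisors [a] and [b] there is a greatest
      left divisor [d] of [b] for which the product [a d] is still defined.

    - Let a generator [a] send [(b, t)], with [b = d r], to [(a d, r t)]. This
      respects the relations of the presentation, so the monoid acts on pairs
      (divisor, monoid element), and acting by [m] multiplies the product of the
      pair by [m] ([peel_prod], [peelK]). Acting on [(1, 1)] splits each [m] into its
      greatest left factor among the generators and a remainder, both depending
      on [m] only. Since [d] can be read off from [a] and [a d], the pair of [m]
      can be recovered from that of [a m] up to its product: this is left
      cancellation ([gen_cancel]). The first component shows that joins of
      generators remain joins in the whole monoid ([ex_head], [mldvd_gen]).

    - The monoid is now itself a left germ, with everywhere defined product,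
      and any two of its elements have a common multiple because all generators
      divide [c] ([common_multiple]). The poset lemma applies a second time and
      gives the lattice property ([presented_left_lattice]). *)

Set Implicit Arguments.
Unset Strict Implicit.
Unset Printing Implicit Defensive.

(** * Joins in ranked posets *)

Lemma eq_is_lub (T : Type) (le le' : T -> T -> Prop) a b m :
  (forall x y, le x y <-> le' x y) ->
  is_lub_in setT le a b m -> is_lub_in setT le' a b m.
Proof.
move=> ll [_ am bm mlub]; split=> //; try exact/ll.
by move=> x _ /ll ax /ll bx; apply/ll/mlub.
Qed.

Section RankedPosets.
Variables (T : Type) (le : T -> T -> Prop) (rk : T -> nat).
Hypothesis le_refl : forall x, le x x.
Hypothesis le_trans : forall x y z, le x y -> le y z -> le x z.
Hypothesis rk_lt : forall x y, le x y -> x <> y -> (rk x < rk y)%N.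

Lemma ranked_anti x y : le x y -> le y x -> x = y.
Proof.
move=> xy yx; apply: contrapT => nxy.
have := ltn_trans (rk_lt xy nxy) (rk_lt yx (nesym nxy)).
by rewrite ltnn.
Qed.

Lemma ranked_leq x y : le x y -> (rk x <= rk y)%N.
Proof.
by move=> xy; have [->//|/(rk_lt xy)/ltnW] := pselect (x = y).
Qed.

Hypothesis local_joins : forall x y z w, le x y -> le x z -> le y w -> le z w ->
  x <> y -> x <> z -> exists y' z' m,
    [/\ le x y' /\ x <> y', le x z' /\ x <> z', le y' y, le z' z &
        is_lub_in setT le y' z' m].

(** Induction on the corank of [x] below the common bound [w]. With [m] the join
    of [y'] and [z'] just above [x], the join [p] of [y] and [m] exists above
    [y'], then the join [q] of [z] and [p] exists above [z'], and [q] is the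
    join of [y] and [z]. *)
Lemma bounded_joins x y z w : le x y -> le x z -> le y w -> le z w ->
  exists m, is_lub_in setT le y z m.
Proof.
move: {2}(rk w - rk x)%N (leqnn (rk w - rk x)%N) => n.
elim: n x y z => [|n IHn] x y z rn xy xz yw zw.
all: have [<-|nxy] := pselect (x = y); first by exists z; split.
all: have [<-|nxz] := pselect (x = z); first by exists y; split.
  have := leq_trans (rk_lt xy nxy) (ranked_leq yw).
  by rewrite -subn_gt0 ltnNge rn.
have [y' [z' [m [[xy' nxy'] [xz' nxz'] y'y z'z [_ y'm z'm mlub]]]]] :=
  local_joins xy xz yw zw nxy nxz.
have up u : le x u -> x <> u -> le u w -> (rk w - rk u <= n)%N.
  move=> xu nxu uw; have xltu := rk_lt xu nxu.
  rewrite -ltnS; apply: leq_trans rn; apply: ltn_sub2l => //.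
  exact: leq_trans xltu (ranked_leq uw).
have y'w := le_trans y'y yw; have z'w := le_trans z'z zw.
have mw : le m w by apply: mlub.
have [p [_ yp mp plub]] := IHn y' y m (up _ xy' nxy' y'w) y'y y'm yw mw.
have pw : le p w by apply: plub.
have [q [_ zq pq qlub]] :=
  IHn z' z p (up _ xz' nxz' z'w) z'z (le_trans z'm mp) zw pw.
exists q; split=> //; first exact: le_trans pq.
move=> u _ yu zu; apply: qlub => //; apply: plub => //.
by apply: mlub => //; [exact: le_trans yu|exact: le_trans zu].
Qed.

(** A common lower bound of maximal rank is the meet: its join with any other
    common lower bound is again one. *)
Lemma bounded_joins_lattice e : (forall x, le e x) ->
  (forall x y, exists w, le x w /\ le y w) -> is_lattice le.
Proof.
move=> e_min directed.
have joins x y : exists m, is_lub_in setT le x y m.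
  by have [w [xw yw]] := directed x y; apply: (bounded_joins (e_min x)) yw.
split=> //; first exact: ranked_anti.
move=> y z.
have ex_rk : exists n, `[< exists d, [/\ le d y, le d z & rk d = n] >].
  by exists (rk e); apply/asboolP; exists e.
have rk_max n : `[< exists d, [/\ le d y, le d z & rk d = n] >] ->
    (n <= rk y)%N.
  by move=> /asboolP [d [/ranked_leq dy _ <-]].
have [n /asboolP [d [dy dz dn]] nmax] := ex_maxnP ex_rk rk_max.
exists d; split=> // d' _ d'y d'z.
have [m [_ dm d'm mlub]] := joins d d'.
have my : le m y by apply: mlub.
have mz : le m z by apply: mlub.
have [->//|/(rk_lt dm)] := pselect (d = m).
rewrite ltnNge dn => /negP []; apply: nmax; apply/asboolP; by exists m.
Qed.

End RankedPosets.

(** * Germs and their divisibility lattice *)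

Section Germs.
Variable P : Type.
Implicit Types (T : P -> P -> P -> Prop) (e c : P) (ln : P -> nat).

(** A unital cancellative partial product that is associative whenever one side
    is defined, with an additive length vanishing only at the unit. [T a b v]
    reads: the product of [a] and [b] is defined and equal to [v]. *)
Record left_germ T e ln : Prop := LeftGerm {
  germ_1mul : forall a, T e a a;
  germ_mul1 : forall a, T a e a;
  germ_fun : forall a b v w, T a b v -> T a b w -> v = w;
  germ_cancel : forall a b b' v, T a b v -> T a b' v -> b = b';
  germ_assocr : forall a b d u v, T a b u -> T u d v ->
    exists2 x, T b d x & T a x v;
  germ_assocl : forall a b d x v, T b d x -> T a x v ->
    exists2 u, T a b u & T u d v;
  germ_len : forall a b v, T a b v -> ln v = (ln a + ln b)%N;
  germ_len0 : forall a, ln a = 0%N -> a = e }.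

Definition gdvd T a b : Prop := exists x, T a x b.

(** Below two nontrivial elements lie two nontrivial ones having a join; for the
    divisors of [c] these are atoms, for a monoid they are generators. *)
Definition atom_joins T e : Prop := forall a b, a <> e -> b <> e ->
  exists a' b' m, [/\ a' <> e, b' <> e, gdvd T a' a, gdvd T b' b &
    is_lub_in setT (gdvd T) a' b' m].

Section LeftGerm.
Variables (T : P -> P -> P -> Prop) (e : P) (ln : P -> nat).
Hypothesis gT : left_germ T e ln.

Lemma gdvd_refl a : gdvd T a a.
Proof. by exists e; apply: (germ_mul1 gT a). Qed.

Lemma gdvd_trans a b d : gdvd T a b -> gdvd T b d -> gdvd T a d.
Proof.
by move=> [x ax] [y bY]; have [z _] := germ_assocr gT ax bY; exists z.
Qed.

Lemma gdvd_len a b : gdvd T a b -> a <> b -> (ln a < ln b)%N.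
Proof.
move=> [x ax] nab; rewrite (germ_len gT ax) -addn1 leq_add2l lt0n.
apply/eqP => /(germ_len0 gT) xe; apply: nab; rewrite xe in ax.
exact: (germ_fun gT (germ_mul1 gT a) ax).
Qed.

Lemma gdvd_anti a b : gdvd T a b -> gdvd T b a -> a = b.
Proof. exact: (ranked_anti gdvd_len). Qed.

(** Left translation by [x] is an order isomorphism from its domain of definition
    onto the multiples of [x]. *)
Lemma gdvd_shift x a b u v : T x a u -> T x b v -> (gdvd T u v <-> gdvd T a b).
Proof.
move=> xa xb; split=> [[k uk]|[k ak]].
  have [y ay xy] := germ_assocr gT xa uk.
  by rewrite (germ_cancel gT xb xy); exists k.
have [w xaw wk] := germ_assocl gT ak xb.
by rewrite (germ_fun gT xa xaw); exists k.
Qed.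

Lemma germ_lattice : atom_joins T e ->
  (forall a b, exists w, gdvd T a w /\ gdvd T b w) -> is_lattice (gdvd T).
Proof.
move=> aj; apply: (@bounded_joins_lattice _ _ ln _ _ gdvd_len _ e).
- exact: gdvd_refl.
- exact: gdvd_trans.
- move=> x y z w [y1 xy] [z1 xz] yw zw nxy nxz.
  have ne t u : T x t u -> x <> u -> t <> e.
    by move=> xt nxu te; apply: nxu; rewrite te in xt;
      apply: (germ_fun gT (germ_mul1 gT x) xt).
  have [a [b [m [nae nbe ay bz [_ am bm mlub]]]]] :=
    aj _ _ (ne _ _ xy nxy) (ne _ _ xz nxz).
  have prod_of t s u : gdvd T t s -> T x s u -> exists2 v, T x t v & gdvd T v u.
    by move=> [k tk] xs; have [v xt vk] := germ_assocl gT tk xs;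
      exists v => //; exists k.
  have [y' xa y'y] := prod_of _ _ _ ay xy.
  have [z' xb z'z] := prod_of _ _ _ bz xz.
  have [w1 xw] : gdvd T x w by apply: gdvd_trans yw; exists y1.
  (* Dividing [w] by [x] turns [w] into [w1], a common multiple of [a], [b]. *)
  have mw : gdvd T m w1.
    apply: mlub => //.
      by apply/(gdvd_shift xa xw); apply: gdvd_trans yw.
    by apply/(gdvd_shift xb xw); apply: gdvd_trans zw.
  have [j xm jw] := prod_of _ _ _ mw xw.
  have neq t u : t <> e -> T x t u -> x <> u.
    move=> nte xt xu; apply: nte; apply: (germ_cancel gT xt).
    by rewrite -xu; apply: (germ_mul1 gT x).
  exists y', z', j; split=> //.
  + by split; [exists a|exact: neq xa].
  + by split; [exists b|exact: neq xb].
  split=> //; try by apply/gdvd_shift; eassumption.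
  move=> u _ y'u z'u.
  have [u1 xu] : gdvd T x u by apply: gdvd_trans y'u; exists a.
  apply/(gdvd_shift xm xu); apply: mlub => //.
    exact/(gdvd_shift xa xu).
  exact/(gdvd_shift xb xu).
- by move=> x; exists x; apply: (germ_1mul gT x).
Qed.

End LeftGerm.
End Germs.

(** * The monoid presented by a germ *)

Section Presented.
Local Open Scope group_scope.
Variable P : Type.
Implicit Types (T : P -> P -> P -> Prop) (e c : P) (ln : P -> nat).

(** The universal property of the presentation is stated for left actions, the
    only form in which it is used; this lets the converse monoid be treated on
    the same footing. *)
Definition presents T e (M : monoidType) (gen : P -> M) : Prop :=
  [/\ forall m, exists s, \prod_(a <- s) gen a = m,
      gen e = 1,
      forall a b v, T a b v -> gen a * gen b = gen v &
      forall (X : Type) (act : P -> X -> X),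
        (forall x, act e x = x) ->
        (forall a b v x, T a b v -> act a (act b x) = act v x) ->
        forall s t x, \prod_(a <- s) gen a = \prod_(a <- t) gen a ->
          foldr act x s = foldr act x t].

Variables (T : P -> P -> P -> Prop) (e c : P) (ln : P -> nat).
Hypothesis gT : left_germ T e ln.
Hypothesis aT : atom_joins T e.
Hypothesis dvd_top : forall a, gdvd T a c.

(** [b = d r] where [d] is the largest left factor of [b] that can be multiplied
    on the left by [a] inside the germ; then [v = a d], and [r] remains. *)
Definition absorbs a b v r : Prop := exists d,
  [/\ T d r b, T a d v & forall d' u, gdvd T d' b -> T a d' u -> gdvd T d' d].

(** The factor is the meet of [b] with the complement [a'] of [a] in [c]: the
    product of [a] and [d] is defined exactly when [d] divides [a']. *)
Lemma absorbs_ex a b : exists vr : P * P, absorbs a b vr.1 vr.2.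
Proof.
have directed x y : exists w, gdvd T x w /\ gdvd T y w.
  by exists c; split; apply: dvd_top.
have [_ _ _ _ meets] := germ_lattice gT aT directed.
have [a' aa'] := dvd_top a.
have [d [_ [k dk] [r dr] dmax]] := meets a' b.
have [v ad _] := germ_assocl gT dk aa'.
exists (v, r), d; split=> // d' u d'b ad'.
apply: dmax => //; have [l ul] := dvd_top u.
by have [y d'y /(germ_cancel gT aa') ->] := germ_assocr gT ad' ul; exists l.
Qed.

Lemma absorbs_fun a b v r v' r' :
  absorbs a b v r -> absorbs a b v' r' -> v = v' /\ r = r'.
Proof.
move=> [d [dr ad dmax]] [d' [dr' ad' dmax']].
have dd' : d = d'.
  apply: (gdvd_anti gT).
    by apply: dmax' ad; exists r.
  by apply: dmax ad'; exists r'.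
rewrite -dd' in dr' ad'.
by split; [exact: (germ_fun gT ad ad')|exact: (germ_cancel gT dr dr')].
Qed.

Lemma absorbs1 b : absorbs e b b e.
Proof.
exists b; split=> //; [exact: (germ_mul1 gT b)|exact: (germ_1mul gT b)].
Qed.

Lemma absorbs_one a : absorbs a e a e.
Proof.
exists e; split; [exact: (germ_1mul gT e)|exact: (germ_mul1 gT a)|by []].
Qed.

(** Letting [b] absorb from [q], then [a] from the result [p], amounts to letting
    their product [v] absorb from [q]: this is what the relations require. The
    factor [g] of [p] taken by [a] is a multiple [b k] of [b], and [k] is the
    factor of [q] taken by [v]. *)
Lemma absorbs_mul a b v q p r w s : T a b v ->
  absorbs b q p r -> absorbs a p w s ->
  exists2 r', T s r r' & absorbs v q w r'.
Proof.
move=> abv [d [dr bd dmax]] [g [gs ag gmax]].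
have [k bk] : gdvd T b g by apply: gmax abv; exists d.
have [d0 ks bd0] := germ_assocr gT bk gs.
rewrite (germ_cancel gT bd0 bd) {d0 bd0} in ks.
have [r' sr kr'] := germ_assocr gT ks dr.
exists r' => //; exists k; split=> //.
  have [u abu uk] := germ_assocl gT bk ag.
  by rewrite (germ_fun gT abv abu).
move=> k' u k'q vk'.
have [x bk' ax] := germ_assocr gT abv vk'.
apply/(gdvd_shift gT bk' bk); apply: gmax ax.
by apply/(gdvd_shift gT bk' bd); apply: dmax bk'.
Qed.

Definition absorb a b : P * P := projT1 (cid (absorbs_ex a b)).

Lemma absorbP a b : absorbs a b (absorb a b).1 (absorb a b).2.
Proof. by rewrite /absorb; case: cid. Qed.

Lemma absorbE a b v r : absorbs a b v r -> absorb a b = (v, r).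
Proof.
move=> abvr; have [] := absorbs_fun (absorbP a b) abvr.
by case: absorb => ? ? /= -> ->.
Qed.

Variables (M : monoidType) (gen : P -> M).
Hypothesis presM : presents T e gen.

Let gens m : exists s, \prod_(a <- s) gen a = m.
Proof. by case: presM. Qed.
Let gen1 : gen e = 1. Proof. by case: presM. Qed.
Let genM a b v : T a b v -> gen a * gen b = gen v.
Proof. by case: presM => _ _ H _; apply: H. Qed.

Let prod_cons a s :
  gen a * (\prod_(j <- s) gen j) = \prod_(j <- a :: s) gen j.
Proof. by rewrite big_cons. Qed.

(** The relations preserve the total length of words, which is read off through
    the action of the monoid on [nat] by adding lengths. *)
Lemma ex_weight : exists L : M -> nat,
  [/\ forall m n, L (m * n) = (L m + L n)%N, forall a, L (gen a) = ln a &
      forall m, L m = 0%N -> m = 1].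
Proof.
pose act a n := (ln a + n)%N.
have len1 : ln e = 0%N.
  by have /eqP := germ_len gT (germ_1mul gT e);
     rewrite -{1}[ln e]addn0 eqn_add2l => /eqP.
pose wd m := projT1 (cid (gens m)).
have wdK m : \prod_(a <- wd m) gen a = m by rewrite /wd; case: cid.
pose L m := foldr act 0%N (wd m).
have LE s : L (\prod_(a <- s) gen a) = foldr act 0%N s.
  case: presM => _ _ _ /(_ nat act); rewrite /act; apply => [n|a b v n abv|].
  - by rewrite len1.
  - by rewrite (germ_len gT abv) addnA.
  - by rewrite wdK.
have fold_act s n : foldr act n s = (foldr act 0 s + n)%N.
  by elim: s => //= a s ->; rewrite /act addnA.
exists L; split.
- move=> m n; rewrite -{1}[m]wdK -{1}[n]wdK -big_cat LE foldr_cat fold_act.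
  by [].
- by move=> a; have := LE [:: a]; rewrite big_seq1 /= /act addn0.
- move=> m; rewrite -[m]wdK LE; elim: (wd m) => [|a s IHs] /=.
    by rewrite big_nil.
  rewrite /act => /eqP; rewrite addn_eq0 => /andP [/eqP a0 /eqP /IHs s1].
  by rewrite big_cons s1 (germ_len0 gT a0) gen1 mulg1.
Qed.

(** A pair [(b, t)] stands for the product of [b] and [t]; acting by [a] moves as
    much of [b] as possible into [a] and returns the rest to [t]. *)
Definition peel_act a (bt : P * M) : P * M :=
  ((absorb a bt.1).1, gen (absorb a bt.1).2 * bt.2).

Definition peel (s : seq P) : P * M := foldr peel_act (e, 1) s.

Lemma peel_prod s t :
  \prod_(a <- s) gen a = \prod_(a <- t) gen a -> peel s = peel t.
Proof.
case: presM => _ _ _; apply=> [[b t']|a b v [q t'] abv] /=.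
  by rewrite /peel_act (absorbE (absorbs1 b)) /= gen1 mul1g.
rewrite /peel_act /=.
have [r' sr vq] := absorbs_mul abv (absorbP b q) (absorbP a (absorb b q).1).
by rewrite (absorbE vq) /= mulgA (genM sr).
Qed.

Lemma peelK s : gen (peel s).1 * (peel s).2 = \prod_(a <- s) gen a.
Proof.
elim: s => [|a s IHs] /=; first by rewrite big_nil gen1 mulg1.
rewrite big_cons -IHs /peel_act /=.
have [d [dr ad _]] := absorbP a (peel s).1.
by rewrite -(genM ad) -(genM dr) !mulgA.
Qed.

(** Equal products on both sides give equal absorbed factors [d], by
    cancellation in the germ, and equal remainders; [y] and [z] are rebuilt
    from these. *)
Lemma gen_cancel a y z : gen a * y = gen a * z -> y = z.
Proof.
have [s <-] := gens y; have [t <-] := gens z.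
rewrite !prod_cons => /peel_prod /=.
rewrite -!peelK /peel_act.
have [d [dr ad _]] := absorbP a (peel s).1.
have [d' [dr' ad' _]] := absorbP a (peel t).1.
case=> E1 E2; rewrite -E1 in ad'; rewrite (germ_cancel gT ad' ad) in dr'.
by rewrite -(genM dr) -(genM dr') -!mulgA E2.
Qed.

Lemma presented_left_cancel : left_cancellative M.
Proof.
move=> x y z; have [s <-] := gens x.
elim: s y z => [|a s IHs] y z; first by rewrite big_nil !mul1g.
by rewrite big_cons -!mulgA => /gen_cancel /IHs.
Qed.

(** The first component of the peeled pair is the greatest generator dividing
    [m]: peeling the product of [a] and [y] produces a multiple of [a]. *)
Lemma ex_head m : exists h, mldvd (gen h) m /\
  forall a, mldvd (gen a) m -> gdvd T a h.
Proof.
have [s <-] := gens m; exists (peel s).1; split.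
  by exists (peel s).2; rewrite peelK.
move=> a [y]; have [t <-] := gens y; rewrite prod_cons => /peel_prod -> /=.
by have [d [_ ad _]] := absorbP a (peel t).1; exists d.
Qed.

Lemma mldvd_gen a b : mldvd (gen a) (gen b) <-> gdvd T a b.
Proof.
split=> [[y]|[x ax]]; last by exists (gen x); rewrite (genM ax).
have [t <-] := gens y; rewrite prod_cons.
have -> : gen b = \prod_(j <- [:: b]) gen j by rewrite big_seq1.
move=> /peel_prod /=.
rewrite /peel_act /= (absorbE (absorbs_one b)) => -[-> _].
by have [d [_ ad _]] := absorbP a (peel t).1; exists d.
Qed.

(** Ore condition against a single generator, by induction on a word for [m]:
    with [a a' = c = b b'], a common multiple of [b'] and the rest of the word
    gives one of [a] and the whole word. *)
Lemma gen_common_multiple a m : exists p q, gen a * p = m * q.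
Proof.
have [s <-] := gens m; elim: s a => [|b s IHs] a.
  by exists 1, (gen a); rewrite big_nil mul1g mulg1.
have [a' aa'] := dvd_top a; have [b' bb'] := dvd_top b.
have [p [q b'p]] := IHs b'.
exists (gen a' * p), q.
by rewrite mulgA (genM aa') -(genM bb') -mulgA b'p big_cons mulgA.
Qed.

Lemma common_multiple (m n : M) : exists w, mldvd m w /\ mldvd n w.
Proof.
suff [p [q pq]] : exists p q, m * p = n * q.
  by exists (m * p); split; [exists p|exists q].
have [s <-] := gens m; elim: s n => [|a s IHs] n.
  by exists n, 1; rewrite big_nil mul1g mulg1.
have [p [q ap]] := gen_common_multiple a n.
have [r [t sr]] := IHs p.
by exists r, (q * t); rewrite big_cons -mulgA sr !mulgA ap.
Qed.

Lemma ex_gen_dvd m : m <> 1 -> exists2 a, a <> e & mldvd (gen a) m.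
Proof.
have [s <-] := gens m; elim: s => [|a s IHs]; first by rewrite big_nil.
rewrite big_cons; have [->|nae _] := pselect (a = e).
  by rewrite gen1 mul1g => /IHs.
by exists a => //; exists (\prod_(j <- s) gen j).
Qed.

(** Cancellation and the weight make the monoid a left germ. Joins of generators
    in the germ are joins in the monoid, since a common multiple [w] of two
    generators has a head that is a common multiple of both. *)
Lemma presented_left_lattice : is_lattice (@mldvd M).
Proof.
have [L [LM Lgen L0]] := ex_weight.
change (is_lattice (gdvd (fun a b v : M => v = a * b))).
apply: (@germ_lattice M (fun a b v : M => v = a * b) 1 L).
- split=> //.
  + by move=> a; rewrite mul1g.
  + by move=> a; rewrite mulg1.
  + by move=> a b v w -> ->.
  + by move=> a b b' v -> /presented_left_cancel.
  + by move=> a b d u v -> ->; exists (b * d); rewrite ?mulgA.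
  + by move=> a b d u v -> ->; exists (a * b); rewrite ?mulgA.
  + by move=> a b v ->; apply: LM.
- move=> m n m1 n1; have [a nae am] := ex_gen_dvd m1.
  have [b nbe bn] := ex_gen_dvd n1.
  have nontriv p : p <> e -> gen p <> 1.
    move=> npe p1; apply: npe; apply: (germ_len0 gT); rewrite -Lgen p1.
    by have /eqP := LM 1 1; rewrite mulg1 -{1}[L 1]addn0 eqn_add2l => /eqP.
  have [_ _ _ joins _] := germ_lattice gT aT
    (fun x y => ex_intro _ c (conj (dvd_top x) (dvd_top y))).
  have [j [_ aj bj jlub]] := joins a b.
  exists (gen a), (gen b), (gen j); split=> //; try exact: nontriv.
  split=> //; try exact/mldvd_gen.
  move=> w _ aw bw; have [h [[k wE] hmax]] := ex_head w.
  have /mldvd_gen [l jl] : gdvd T j h.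
    by apply: jlub => //; apply: hmax.
  by exists (l * k); rewrite wE jl mulgA.
- exact: common_multiple.
Qed.

(** A word dividing the generator [p] on the left starts with a divisor [a] of
    [p]; the rest of the word divides the complement of [a] in [p], and the
    letters can be multiplied together inside the germ. *)
Lemma presented_left_dvd_gen m p : mldvd m (gen p) -> exists a, m = gen a.
Proof.
have [s <-] := gens m; elim: s p => [|a s IHs] p.
  by exists e; rewrite big_nil gen1.
rewrite big_cons => -[y]; rewrite -mulgA => pE.
have /mldvd_gen [p' ap'] : mldvd (gen a) (gen p) by eexists; exact: pE.
have p'E : gen p' = (\prod_(j <- s) gen j) * y.
  by apply: (@gen_cancel a); rewrite (genM ap') pE.
have [|n sn] := IHs p'; first by exists y.
have /mldvd_gen [k nk] : mldvd (gen n) (gen p') by exists y; rewrite -sn.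
have [u an _] := germ_assocl gT nk ap'.
by exists u; rewrite sn (genM an).
Qed.

Lemma presented_dvd_top m : mldvd m (gen c) <-> exists a, m = gen a.
Proof.
split=> [/presented_left_dvd_gen//|[a ->]].
exact/mldvd_gen.
Qed.

Lemma presented_bounded : bounded_factorizations M.
Proof.
have [L [LM _ L0]] := ex_weight.
move=> m; exists (L m) => s sn <- {m}; elim: s sn => // x s IHs sn.
rewrite big_cons LM /= -add1n leq_add ?lt0n //.
  by apply/eqP => /L0; apply: sn; rewrite mem_head.
by apply: IHs => y ys; apply: sn; rewrite in_cons ys orbT.
Qed.

End Presented.

(** * Converse monoids and presentations by relations *)

Section Converse.
Local Open Scope group_scope.

Definition converse (M : monoidType) : Type := M.

HB.instance Definition _ (M : monoidType) := Choice.on (converse M).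

Definition converse_mul (M : monoidType) (x y : converse M) : converse M :=
  (y : M) * (x : M).

Lemma converse_mulA (M : monoidType) : associative (@converse_mul M).
Proof. by move=> x y z; apply: esym; apply: (@mulgA M). Qed.

Lemma converse_mul1 (M : monoidType) : left_id (1 : M) (@converse_mul M).
Proof. exact: (@mulg1 M). Qed.

Lemma converse_mulr1 (M : monoidType) : right_id (1 : M) (@converse_mul M).
Proof. exact: (@mul1g M). Qed.

HB.instance Definition _ (M : monoidType) := isMonoid.Build (converse M)
  (@converse_mulA M) (@converse_mul1 M) (@converse_mulr1 M).

Lemma converse_prod (M : monoidType) (P : Type) (gen : P -> M) s :
  \prod_(a <- s) (gen a : converse M) = \prod_(a <- rev s) gen a.
Proof.
elim: s => [|a s IHs]; first by rewrite !big_nil.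
by rewrite big_cons IHs rev_cons -cats1 big_cat big_seq1.
Qed.

End Converse.

Section GermPresentation.
Local Open Scope group_scope.
Local Open Scope quotient_scope.
Variables (P : choiceType) (T : P -> P -> P -> Prop) (e : P).
Variable r : seq P -> seq P -> Prop.
Hypothesis rP : forall s t, r s t <->
  (exists a b v, [/\ T a b v, s = [:: a; b] & t = [:: v]]) \/
  (s = [:: e] /\ t = [::]).

Let gen : P -> presented r := presented_gen r.

Lemma presented_gen_prod s : \prod_(a <- s) gen a = \pi_(presented r) s.
Proof.
elim: s => [|a s IHs]; first by rewrite big_nil.
by rewrite big_cons IHs; apply: (presented_mul_pi r [:: a] s).
Qed.

Lemma presented_gen1 : gen e = 1.
Proof. by apply/presentedP/gen_cong_rel/rP; right. Qed.

Lemma presented_genM a b v : T a b v -> gen a * gen b = gen v.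
Proof.
move=> abv; have := presented_gen_prod [:: a; b].
rewrite big_cons big_seq1 => ->; apply/presentedP/gen_cong_rel/rP.
by left; exists a, b, v.
Qed.

Lemma presented_act (X : Type) (act : P -> X -> X) :
  (forall x, act e x = x) ->
  (forall a b v x, T a b v -> act a (act b x) = act v x) ->
  forall s t, gen_cong r s t -> forall x, foldr act x s = foldr act x t.
Proof.
move=> act1 actM s t; elim=> {s t} //.
- move=> s t /rP [[a [b [v [abv -> ->]]]]|[-> ->]] x /=; first exact: actM.
  exact: act1.
- by move=> s t u _ st _ tu x; rewrite st.
- by move=> s s' t t' _ ss _ tt x; rewrite !foldr_cat ss tt.
Qed.

Lemma presented_act_rev (X : Type) (act : P -> X -> X) :
  (forall x, act e x = x) ->
  (forall a b v x, T a b v -> act b (act a x) = act v x) ->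
  forall s t, gen_cong r s t ->
  forall x, foldr act x (rev s) = foldr act x (rev t).
Proof.
move=> act1 actM s t; elim=> {s t} //.
- move=> s t /rP [[a [b [v [abv -> ->]]]]|[-> ->]] x /=; first exact: actM.
  exact: act1.
- by move=> s t u _ st _ tu x; rewrite st.
- by move=> s s' t t' _ ss _ tt x; rewrite !rev_cat !foldr_cat ss tt.
Qed.

Lemma germ_presents : presents T e gen.
Proof.
split; [|exact: presented_gen1|exact: presented_genM|].
  by move=> m; exists (repr m); rewrite presented_gen_prod reprK.
move=> X act act1 actM s t x; rewrite !presented_gen_prod => /presentedP st.
exact: presented_act st x.
Qed.

(** A left action of the converse monoid reads words backwards. *)
Lemma germ_presents_converse :
  presents (fun a b => T b a) e (gen : P -> converse (presented r)).
Proof.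
split; [|exact: presented_gen1|by move=> a b v; apply: presented_genM|].
  move=> m; exists (rev (repr m)).
  by rewrite converse_prod revK presented_gen_prod reprK.
move=> X act act1 actM s t x; rewrite !converse_prod !presented_gen_prod.
move=> /presentedP st; rewrite -[s]revK -[t]revK.
by apply: presented_act_rev st x => // a b v x; apply: actM.
Qed.

End GermPresentation.

(** * The germ of divisors of a balanced element *)

Section DivisorGerm.
Local Open Scope group_scope.
Variables (G : groupType) (R : set G).
Hypothesis R_generates : monoid_generates R.
Local Notation l := (len R).

Lemma ex_min_word g : exists s : seq G,
  [/\ forall x, x \in s -> R x, size s = l g & \prod_(x <- s) x = g].
Proof.
rewrite /len; case: pselect => [ex|[]]; last first.
  have [s sR sg] := R_generates g.
  by exists (size s); apply/asboolP; exists s.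
by case: ex_minnP => n /asboolP.
Qed.

Lemma len_prod s : (forall x, x \in s -> R x) ->
  (l (\prod_(x <- s) x) <= size s)%N.
Proof.
move=> sR; rewrite /len; case: pselect => // ex.
case: ex_minnP => n _; apply; apply/asboolP; by exists s.
Qed.

Lemma len_mul g h : (l (g * h) <= l g + l h)%N.
Proof.
have [s [sR <- sg]] := ex_min_word g; have [t [tR <- th]] := ex_min_word h.
rewrite -size_cat -{1}sg -{1}th -big_cat; apply: len_prod => x.
by rewrite mem_cat => /orP [/sR|/tR].
Qed.

Lemma len_eq0 g : l g = 0%N -> g = 1.
Proof.
by have [s [_ <- <-]] := ex_min_word g => /size0nil ->; rewrite big_nil.
Qed.

(** Both sides say that the length of [a b d] is the sum of the three lengths,
    because lengths are subadditive. *)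
Lemma len_mul_assoc a b d :
  (l (a * b) = (l a + l b)%N /\ l (a * b * d) = (l (a * b) + l d)%N) <->
  (l (b * d) = (l b + l d)%N /\ l (a * (b * d)) = (l a + l (b * d))%N).
Proof.
have tight x y z : (l x + (l y + l z) <= l (x * (y * z)))%N ->
    (l x + l y <= l (x * y))%N /\ (l y + l z <= l (y * z))%N.
  move=> xyz; split.
    rewrite -(leq_add2r (l z)) -addnA; apply: leq_trans xyz _.
    by rewrite mulgA len_mul.
  by rewrite -(leq_add2l (l x)); apply: leq_trans xyz (len_mul _ _).
have len_eq x y : (l x + l y <= l (x * y))%N -> l (x * y) = (l x + l y)%N.
  by move=> xy; apply/eqP; rewrite eqn_leq len_mul xy.
split=> [[ab abd]|[bd abd]].
  have [|_ /len_eq bd] := tight a b d; first by rewrite mulgA abd ab addnA.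
  by rewrite bd mulgA abd ab addnA.
have [|/len_eq ab _] := tight a b d; first by rewrite abd bd.
by rewrite ab -mulgA abd bd addnA.
Qed.

Lemma ldvd_trans a b d : ldvd R a b -> ldvd R b d -> ldvd R a d.
Proof.
move=> [x [-> ax]] [y [-> axy]].
have [_ xy] := (len_mul_assoc a x y).1 (conj ax axy).
by exists (x * y); rewrite mulgA -xy mulgA.
Qed.

Lemma rdvd_trans a b d : rdvd R a b -> rdvd R b d -> rdvd R a d.
Proof.
move=> [x [-> xa]] [y [-> yxa]].
have [_ yx] := (len_mul_assoc y x a).2 (conj xa yxa).
by exists (y * x); rewrite -mulgA -yx -mulgA.
Qed.

(** The first letter of a word of minimal length: it is nontrivial, since
    otherwise dropping it would shorten the word. *)
Lemma ex_latom g : g <> 1 -> exists a, [/\ R a, a <> 1 & ldvd R a g].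
Proof.
have [[|a s] [sR sl gE]] := ex_min_word g; rewrite -{}gE in sl *.
  by rewrite big_nil.
rewrite big_cons in sl * => _.
have la : (l a <= 1)%N.
  rewrite -[a](@big_seq1 _ 1 *%g _ a id) (len_prod (s := [:: a])) // => x.
  by rewrite inE => /eqP ->; apply: sR; rewrite mem_head.
have ls : (l (\prod_(x <- s) x) <= size s)%N.
  by apply: len_prod => x xs; apply: sR; rewrite in_cons xs orbT.
have las := len_mul a (\prod_(x <- s) x).
rewrite -sl /= in las.
exists a; split; first by apply: sR; rewrite mem_head.
  move=> a1; move: las; rewrite a1 len1 add0n => /leq_trans/(_ ls).
  by rewrite ltnn.
exists (\prod_(x <- s) x); split=> //; apply/eqP.
by rewrite eqn_leq len_mul -sl /= -add1n leq_add.
Qed.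

Lemma ex_ratom g : g <> 1 -> exists a, [/\ R a, a <> 1 & rdvd R a g].
Proof.
have [s [sR sl gE]] := ex_min_word g; rewrite -{}gE in sl *.
case: (lastP s) sR sl => [|{}s a] sR sl; first by rewrite big_nil.
rewrite -cats1 big_cat big_seq1 /= in sl * => _.
have la : (l a <= 1)%N.
  rewrite -[a](@big_seq1 _ 1 *%g _ a id) (len_prod (s := [:: a])) // => x.
  by rewrite inE => /eqP ->; apply: sR; rewrite mem_rcons mem_head.
have ls : (l (\prod_(x <- s) x) <= size s)%N.
  by apply: len_prod => x xs; apply: sR; rewrite mem_rcons in_cons xs orbT.
have las := len_mul (\prod_(x <- s) x) a.
rewrite -sl size_cat addn1 in las.
exists a; split; first by apply: sR; rewrite mem_rcons mem_head.
  move=> a1; move: las; rewrite a1 len1 addn0 => /leq_trans/(_ ls).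
  by rewrite ltnn.
exists (\prod_(x <- s) x); split=> //; apply/eqP.
by rewrite eqn_leq len_mul -sl size_cat leq_add.
Qed.

Variable c : G.
Hypothesis c_balanced : balanced R c.
Local Notation P := (divs R c).
Implicit Types a b d u v : P.

Definition divs_mul a b v : Prop :=
  val v = val a * val b /\ l (val v) = (l (val a) + l (val b))%N.

Lemma ex_div g : ldvd R g c -> exists a, val a = g.
Proof. by move=> gc; exists (SigSub (mem_set gc : g \in divs R c)). Qed.

Lemma div_ldvd a : ldvd R (val a) c.
Proof. exact: set_mem (valP a). Qed.

Lemma ex_ldiv g v : ldvd R g (val v) -> exists a, val a = g.
Proof. by move=> gv; apply: ex_div; apply: ldvd_trans gv (div_ldvd v). Qed.

(** Balance turns right divisors of [v] into right divisors, hence left divisors,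
    of [c]; this makes the partial product associative. *)
Lemma ex_rdiv g v : rdvd R g (val v) -> exists a, val a = g.
Proof.
move=> gv; apply: ex_div; apply/c_balanced; apply: rdvd_trans gv _.
exact/c_balanced/div_ldvd.
Qed.

Lemma gdvd_ldvd a b : gdvd divs_mul a b <-> ldvd R (val a) (val b).
Proof.
split=> [[x [ax axl]]|[k [bE bl]]]; first by exists (val x).
have [|x xk] := @ex_rdiv k b; first by exists (val a).
by exists x; split; rewrite xk.
Qed.

Lemma gdvd_rdvd a b :
  gdvd (fun x y => divs_mul y x) a b <-> rdvd R (val a) (val b).
Proof.
split=> [[x [ax axl]]|[k [bE bl]]]; first by exists (val x).
have [|x xk] := @ex_ldiv k b; first by exists (val a).
by exists x; split; rewrite xk.
Qed.

Variable e : P.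
Hypothesis eE : val e = 1.

Lemma divs_assocr a b d u v : divs_mul a b u -> divs_mul u d v ->
  exists2 x, divs_mul b d x & divs_mul a x v.
Proof.
move=> [uE ul] [vE vl]; rewrite uE in ul vE vl; rewrite vE in vl.
have [bdl abdl] := (len_mul_assoc (val a) (val b) (val d)).1 (conj ul vl).
have [|x xE] := @ex_rdiv (val b * val d) v.
  by exists (val a); rewrite vE -mulgA abdl.
by exists x; split; rewrite ?vE xE // -?mulgA.
Qed.

Lemma divs_assocl a b d x v : divs_mul b d x -> divs_mul a x v ->
  exists2 u, divs_mul a b u & divs_mul u d v.
Proof.
move=> [xE xl] [vE vl]; rewrite xE in xl vE vl; rewrite vE in vl.
have [abl abdl] := (len_mul_assoc (val a) (val b) (val d)).2 (conj xl vl).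
have [|u uE] := @ex_ldiv (val a * val b) v.
  by exists (val d); rewrite vE mulgA abdl.
by exists u; split; rewrite ?vE uE // ?mulgA.
Qed.

Lemma divs_left_germ : left_germ divs_mul e (fun a => l (val a)).
Proof.
split.
- by move=> a; split; rewrite eE ?mul1g ?len1.
- by move=> a; split; rewrite eE ?mulg1 ?len1 ?addn0.
- by move=> a b v w [vE _] [wE _]; apply: val_inj; rewrite /= vE wE.
- by move=> a b b' v [vE _] [vE' _]; apply/val_inj/(mulgI (val a));
    rewrite /= -vE.
- exact: divs_assocr.
- exact: divs_assocl.
- by move=> a b v [].
- by move=> a /len_eq0 a1; apply: val_inj; rewrite /= a1 -eE.
Qed.

Lemma divs_right_germ :
  left_germ (fun a b => divs_mul b a) e (fun a => l (val a)).
Proof.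
split.
- by move=> a; split; rewrite eE ?mulg1 ?len1 ?addn0.
- by move=> a; split; rewrite eE ?mul1g ?len1.
- by move=> a b v w [vE _] [wE _]; apply: val_inj; rewrite /= vE wE.
- by move=> a b b' v [vE _] [vE' _]; apply/val_inj/(mulIg (val a));
    rewrite /= -vE.
- by move=> a b d u v ba du; apply: divs_assocl ba du.
- by move=> a b d x v ba du; apply: divs_assocr ba du.
- by move=> a b v [_ ->]; rewrite addnC.
- by move=> a /len_eq0 a1; apply: val_inj; rewrite /= a1 -eE.
Qed.

Lemma divs_dvd_top a : gdvd divs_mul a (divs_top R c).
Proof. exact/gdvd_ldvd/div_ldvd. Qed.

Lemma divs_rdvd_top a : gdvd (fun x y => divs_mul y x) a (divs_top R c).
Proof. exact/gdvd_rdvd/c_balanced/div_ldvd. Qed.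

Lemma div_neq1 a : a <> e -> val a <> 1.
Proof. by move=> ae a1; apply: ae; apply: val_inj; rewrite /= a1 -eE. Qed.

Lemma divs_lub (dvd : G -> G -> Prop) (a b : P) m :
  is_lub_in P dvd (val a) (val b) m ->
  exists m', is_lub_in setT (fun x y : P => dvd (val x) (val y)) a b m'.
Proof.
move=> [/ex_div [m' <-] am bm mlub]; exists m'; split=> // x _.
exact/mlub/div_ldvd.
Qed.

Hypothesis atoms_lcm : forall a b : G,
  (R `&` divs R c) a -> (R `&` divs R c) b ->
  (exists m, is_lub_in (divs R c) (ldvd R) a b m) /\
  (exists m, is_lub_in (divs R c) (rdvd R) a b m).

Lemma divs_atom_joins : atom_joins divs_mul e.
Proof.
move=> a b /div_neq1 /ex_latom [p [pR p1 pa]].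
move=> /div_neq1 /ex_latom [q [qR q1 qb]].
have [p' pE] := ex_ldiv pa; have [q' qE] := ex_ldiv qb.
rewrite -{}pE in pR p1 pa *; rewrite -{}qE in qR q1 qb *.
have [[m /divs_lub [m' mlub]] _] :=
  atoms_lcm (conj pR (div_ldvd p')) (conj qR (div_ldvd q')).
exists p', q', m'; split; try exact/gdvd_ldvd.
- by move=> pe; apply: p1; rewrite pe.
- by move=> qe; apply: q1; rewrite qe.
- by apply: eq_is_lub mlub => x y; apply: iff_sym; apply: gdvd_ldvd.
Qed.

Lemma divs_ratom_joins : atom_joins (fun x y => divs_mul y x) e.
Proof.
move=> a b /div_neq1 /ex_ratom [p [pR p1 pa]].
move=> /div_neq1 /ex_ratom [q [qR q1 qb]].
have [p' pE] := ex_rdiv pa; have [q' qE] := ex_rdiv qb.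
rewrite -{}pE in pR p1 pa *; rewrite -{}qE in qR q1 qb *.
have [_ [m /divs_lub [m' mlub]]] :=
  atoms_lcm (conj pR (div_ldvd p')) (conj qR (div_ldvd q')).
exists p', q', m'; split; try exact/gdvd_rdvd.
- by move=> pe; apply: p1; rewrite pe.
- by move=> qe; apply: q1; rewrite qe.
- by apply: eq_is_lub mlub => x y; apply: iff_sym; apply: gdvd_rdvd.
Qed.

Lemma divs_relP s t : divs_rel s t <->
  (exists a b v, [/\ divs_mul a b v, s = [:: a; b] & t = [:: v]]) \/
  (s = [:: e] /\ t = [::]).
Proof.
split=> [[a b v vE vl|x x1]|[[a [b [v [[vE vl] -> ->]]]]|[-> ->]]].
- by left; exists a, b, v.
- by right; split=> //; congr [:: _]; apply: val_inj; rewrite /= eE.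
- exact: divs_rel_mul.
- exact: divs_rel_one.
Qed.

End DivisorGerm.

Theorem mainTheorem3 (G : groupType) (R : set G)
    (R_generates : monoid_generates R)
    (c : G) (c_balanced : balanced R c)
    (atoms_lcm : forall a b : G,
       (R `&` divs R c) a -> (R `&` divs R c) b ->
       (exists m, is_lub_in (divs R c) (ldvd R) a b m) /\
       (exists m, is_lub_in (divs R c) (rdvd R) a b m)) :
  quasi_garside (divs_monoid R c) /\
  garside_element (underline (divs_top R c)).
Proof.
have [e eE] : exists e : divs R c, val e = 1%g.
  by apply: ex_div; exists c; rewrite mul1g len1.
have gL := divs_left_germ R_generates c_balanced eE.
have gR := divs_right_germ R_generates c_balanced eE.
have aL := divs_atom_joins R_generates c_balanced eE atoms_lcm.
have aR := divs_ratom_joins R_generates c_balanced eE atoms_lcm.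
have tL := divs_dvd_top R_generates c_balanced.
have tR := divs_rdvd_top R_generates c_balanced.
have pL := germ_presents (divs_relP eE).
have pR := germ_presents_converse (divs_relP eE).
have garside : garside_element (underline (divs_top R c)).
  have dvdL := presented_dvd_top gL aL tL pL.
  have dvdR := presented_dvd_top gR aR tR pR.
  split=> [m|m]; first exact: iff_trans (dvdL m) (iff_sym (dvdR m)).
  have [/(_ m) [s <-] _ _ _] := pL.
  exists (map (@underline G R c) s); last by rewrite big_map.
  by move=> x /mapP [a _ ->]; apply/dvdL; exists a.
split=> //; split.
- exact: (presented_bounded gL pL).
- split; first exact: (presented_left_cancel gL aL tL pL).
  by move=> x y z; apply: (presented_left_cancel gR aR tR pR).
- split; first exact: (presented_left_lattice gL aL tL pL).
  exact: (presented_left_lattice gR aR tR pR).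
- by exists (underline (divs_top R c)).
Qed.
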